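(* With $\widetilde{\sigma}(\boldsymbol{X})$ the $2n\times 2n$ matrix over $\mathbb{C}[z_{i,j},\xi_{i,j},u\,;\,1\le i\le j\le n]$ defined in the context (case $\mathfrak{g}=\mathfrak{sp}_{n}$), and $\gamma_k=\sum_{I,J\subset[n],\,|I|=|J|=k}\det(z^I_J)\det(\tilde\xi^I_J)$, one has $$\det\bigl(\widetilde{\sigma}(\boldsymbol{X})\bigr)=(-1)^n\sum_{k=0}^{n}(u+\gamma_1)^{2n-2k}\,\bigl(s-(u+\gamma_1)\bigr)^{k}\,\gamma_k .$$
   Context: Fix an integer $n\ge 1$ and $s\in\mathbb{Z}$; $[n]=\{1,\dots,n\}$. Let $z_{i,j},\xi_{i,j}$ ($1\le i\le j\le n$) and $u$ be independent commuting indeterminates; set $z_{j,i}=z_{i,j}$, $\xi_{j,i}=\xi_{i,j}$, and $\tilde\xi_{i,i}=2\xi_{i,i}$, $\tilde\xi_{i,j}=\xi_{i,j}$ for $i\ne j$. For $I,J\subset[n]$, $z^I_J$ and $\tilde\xi^I_J$ are the submatrices of $(z_{i,j})$, $(\tilde\xi_{i,j})$ with row indices in $I$ and column indices in $J$; the empty determinant is $1$. Thus $\gamma_0=1$ and $\gamma_1=\sum_{k,l\in[n]}z_{k,l}\tilde\xi_{k,l}$. ($\gamma_k$ is the principal symbol of the $\mathrm{GL}_n$-invariant differential operator $\varGamma_k=\sum_{|I|=|J|=k}\det(z^I_J)\det(\tilde\partial^I_J)$ on symmetric matrices, $\tilde\partial_{i,i}=2\partial_{i,i}$, $\tilde\partial_{i,j}=\partial_{i,j}$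 for $i\neq j$.) $E_{a,b}$ denotes the $2n\times 2n$ matrix units, and an index $-i$ stands for $2n+1-i$. A basis of $\mathfrak{sp}_{n}$ (complexified Lie algebra of $\mathrm{Sp}(n,\mathbb{R})$) is $X^0_{i,j}=E_{i,j}-E_{-j,-i}$ ($i,j\in[n]$), $X^+_{i,j}=E_{i,-j}+E_{j,-i}$, $X^-_{i,j}=E_{-j,i}+E_{-i,j}$ ($1\le i\le j\le n$). With respect to $B(X,Y)=\frac12\operatorname{tr}(XY)$ the dual basis is $(X^0_{i,j})^\vee=X^0_{j,i}$, $(X^\pm_{i,j})^\vee=X^\mp_{i,j}$ for $i\neq j$, $(X^\pm_{i,i})^\vee=\frac12X^\mp_{i,i}$. Define polynomials $$\widetilde\sigma(X^0_{i,i})=u+\sum_{k,l\in[n];\ l\ne i}z_{k,l}\tilde\xi_{k,l},\qquad \widetilde\sigma(X^0_{i,j})=-\sum_{k=1}^n z_{j,k}\tilde\xi_{i,k}\ (i\ne j),\qquad \widetilde\sigma(X^+_{i,j})=-\tilde\xi_{i,j},$$ $$\widetilde\sigma(X^-_{i,j})=-(u+s)z_{i,j}+\sum_{k,l\in[n]}(z_{k,i}z_{j,l}-z_{i,j}z_{k,l})\,\tilde\xi_{k,l}.$$ (These arise from the symbols, $\tilde\partial_{i,j}\mapsto\tilde\xi_{i,j}$, of the differential operators $d\pi_\lambda(X^\epsilon_{i,j})$ of the holomorphic discrete series, by rewriting those containing $s$ in terms of $\gamma_1$ and substituting $s-u$ for $\gamma_1$.) Extend $\widetilde\sigma$ to $\frac12X^\pm_{i,i}$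 by $\widetilde\sigma(\frac12X^\pm_{i,i})=\frac12\widetilde\sigma(X^\pm_{i,i})$ and put $$\widetilde\sigma(\boldsymbol X)=\sum_{i,j\in[n]}\widetilde\sigma\bigl((X^0_{i,j})^\vee\bigr)X^0_{i,j}+\sum_{i\le j}\widetilde\sigma\bigl((X^+_{i,j})^\vee\bigr)X^+_{i,j}+\sum_{i\le j}\widetilde\sigma\bigl((X^-_{i,j})^\vee\bigr)X^-_{i,j}.$$ *)

(* Defs.v *)
From mathcomp Require Import all_boot all_order all_algebra.
From mathcomp Require Import complex reals mpoly.

Set Implicit Arguments.
Unset Strict Implicit.
Unset Printing Implicit Defensive.

Import GRing.Theory.

Local Open Scope ring_scope.

(* Indices are 0-based: i : 'I_n stands for the index i.+1 of [n]. *)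

(* Pairs (i, j) with i <= j, the index set of the entries of a symmetric
   n x n matrix. *)
Notation upair n := {p : 'I_n * 'I_n | (p.1 <= p.2)%N}.

Fact upair_of_subproof n (i j : 'I_n) :
  let p := if (i <= j)%N then (i, j) else (j, i) in (p.1 <= p.2)%N.
Proof. by case: (leqP i j) => // /ltnW. Qed.

Definition upair_of n (i j : 'I_n) : upair n :=
  exist (fun p : 'I_n * 'I_n => (p.1 <= p.2)%N) _ (upair_of_subproof i j).

(* The independent indeterminates: z_{i,j} (inl (inl _)), xi_{i,j}
   (inl (inr _)) for i <= j, and u (inr tt). *)
Notation indet n := (upair n + upair n + unit)%type.

Section Symbols.

Variables (R : realType) (n : nat).

Local Notation symring := {mpoly R[i][#|{: indet n}|]}.

Definition indetX (v : indet n) : symring := 'X_(enum_rank v).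

Definition uX : symring := indetX (inr tt).

Definition zX : 'M[symring]_n :=
  \matrix_(i, j) indetX (inl (inl (upair_of i j))).

Definition xiX : 'M[symring]_n :=
  \matrix_(i, j) indetX (inl (inr (upair_of i j))).

Definition txiX : 'M[symring]_n :=
  \matrix_(i, j) (if i == j then 2 * xiX i j else xiX i j).

(* det(A^I_J) when #|I| = #|J| = k; enum_val lists a set of ordinals in
   increasing order, and conform_mx only transports the #|I| x #|J|
   submatrix to size k x k. *)
Definition minor (k : nat) (A : 'M[symring]_n) (I J : {set 'I_n}) : symring :=
  \det (conform_mx (0 : 'M_k)
          (mxsub (fun a : 'I_#|I| => enum_val a)
                 (fun b : 'I_#|J| => enum_val b) A)).

Definition gamma (k : nat) : symring :=
  \sum_(I : {set 'I_n} | #|I| == k) \sum_(J : {set 'I_n} | #|J| == k)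
     minor k zX I J * minor k txiX I J.

(* The row/column indices i and -i (that is, 2n+1-i in 1-based numbering). *)
Definition pos (i : 'I_n) : 'I_(n + n) := lshift n i.
Definition neg (i : 'I_n) : 'I_(n + n) := rev_ord (lshift n i).

(* Labels for X^0_{i,j}, X^+_{i,j}, X^-_{i,j}; the last two are symmetric in
   (i, j), and the basis of sp_n only involves those with i <= j. *)
Variant sp_gen := X0 of 'I_n & 'I_n | Xp of 'I_n & 'I_n | Xm of 'I_n & 'I_n.

Definition sp_mx (T : nzRingType) (X : sp_gen) : 'M[T]_(n + n) :=
  match X with
  | X0 i j => delta_mx (pos i) (pos j) - delta_mx (neg j) (neg i)
  | Xp i j => delta_mx (pos i) (neg j) + delta_mx (pos j) (neg i)
  | Xm i j => delta_mx (neg j) (pos i) + delta_mx (neg i) (pos j)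
  end.

(* The dual basis with respect to B(X, Y) = tr(XY) / 2: the pair (c, Y)
   stands for the element c Y of sp_n. *)
Definition sp_dual (X : sp_gen) : R[i] * sp_gen :=
  match X with
  | X0 i j => (1, X0 j i)
  | Xp i j => (if i == j then 2^-1 else 1, Xm i j)
  | Xm i j => (if i == j then 2^-1 else 1, Xp i j)
  end.

Definition tsigma (s : int) (X : sp_gen) : symring :=
  match X with
  | X0 i j =>
      if i == j then uX + \sum_(k < n) \sum_(l < n | l != i) zX k l * txiX k l
      else - \sum_(k < n) zX j k * txiX i k
  | Xp i j => - txiX i j
  | Xm i j =>
      - (uX + s%:~R) * zX i j
      + \sum_(k < n) \sum_(l < n)
           (zX k i * zX j l - zX i j * zX k l) * txiX k l
  end.

Definition tsigma_dual (s : int) (X : sp_gen) : symring :=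
  (sp_dual X).1 *: tsigma s (sp_dual X).2.

Definition tsigmaX (s : int) : 'M[symring]_(n + n) :=
  \sum_(i < n) \sum_(j < n)
     tsigma_dual s (X0 i j) *: sp_mx symring (X0 i j)
  + \sum_(i < n) \sum_(j < n | (i <= j)%N)
     tsigma_dual s (Xp i j) *: sp_mx symring (Xp i j)
  + \sum_(i < n) \sum_(j < n | (i <= j)%N)
     tsigma_dual s (Xm i j) *: sp_mx symring (Xm i j).

End Symbols.

(* Main.v *)
Require Import Defs.
From mathcomp Require Import all_boot all_order all_algebra.
From mathcomp Require Import complex reals mpoly.
From mathcomp Require Import all_fingroup ring.

(** Let Z and T be the symmetric matrices of the z_{i,j} and of the
    tilde-xi_{i,j}, and v = u + gamma_1. Since gamma_1 = tr (Z T), the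
    polynomials attached to the generators are entries of matrix polynomials
    in Z and T: those of X^0 form v - Z T (up to transposition), those of X^+
    form - T, and those of X^- form Z T Z - (v + s) Z. In the ordered basis
    (1, ..., n, -1, ..., -n), the matrix in the statement is therefore
<<
        |  v - Z T    Z T Z - (v + s) Z |
        |   - T           T Z - v       |
>>
    ([tsigmaX_block]); the factors 1/2 of the dual basis compensate for the
    diagonal matrices X^+_{i,i} and X^-_{i,i} having a doubled entry.

    Subtracting Z times the second block row from the first leaves the blocks
    v and - s Z on top. A block matrix whose upper left block is the scalar v
    has determinant det (v D - C B) ([det_block_scalar]), here
    (-1)^n det (v^2 + (s - v) T Z) ([det_symbol_block]).

    It remains to expand det (a + b T Z). By multilinearity in the rows, it is
    the sum over I of a^(n - |I|) b^|I| times the principal minor of T Z on I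
    ([det_add], [det_row_mixed]). By the Cauchy-Binet formula
    ([cauchy_binet]), that minor is the sum over J of
    det (T^I_J) det (Z^J_I), and Z is symmetric, so the sum over all I with
    k elements is gamma_k. *)

Set Implicit Arguments.
Unset Strict Implicit.
Unset Printing Implicit Defensive.

Import GRing.Theory.

Local Open Scope ring_scope.

(* The increasing enumeration of a k-element set I of ordinals. The default x0
   is never reached when #|I| = k; it lets the enumeration be defined without
   a proof of this equality, so that one can sum over all such I. *)
Local Notation elt x0 k I := (fun i : 'I_k => nth x0 (enum I) i).

(** * Determinants over a commutative ring *)

Section Determinants.

Variable K : comNzRingType.

Lemma det_mxsub_inj m n (f : 'I_m -> 'I_n) (A : 'M[K]_n) :
  m = n -> injective f -> \det (mxsub f f A) = \det A.
Proof.
move=> mn; subst m => f_inj.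
have -> : mxsub f f A = row_perm (perm f_inj) (col_perm (perm f_inj) A).
  by apply/matrixP => i j; rewrite !mxE !permE.
rewrite row_permE col_permE !det_mulmx !det_perm mulrCA mulrC odd_permV.
by rewrite -signr_addb addbb mul1r.
Qed.

(** Multiplying on the right by the block matrix with rows 1, - B and 0, a
    makes the matrix block lower triangular, which proves the identity
    multiplied by a ^+ n. To cancel this factor even when a is a zero divisor,
    it is applied to 'X + a, whose powers are monic, and evaluated at 0. *)
Lemma det_block_scalar n a (B C D : 'M[K]_n) :
  \det (block_mx a%:M B C D) = \det (a *: D - C *m B).
Proof.
have det_cancel (L : comNzRingType) (x : L) (B' C' D' : 'M[L]_n) :
    \det (block_mx x%:M B' C' D') * x ^+ n
    = \det (x *: D' - C' *m B') * x ^+ n.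
  rewrite -[in LHS](det_scalar n x).
  transitivity (\det (block_mx x%:M B' C' D' *m block_mx 1%:M (- B') 0 x%:M)).
    by rewrite det_mulmx det_ublock det1 mul1r det_scalar.
  rewrite mulmx_block !mulmx0 !addr0 !mulmx1 mul_scalar_mx mulmxN scalerN.
  rewrite mul_mx_scalar addNr mul_mx_scalar det_lblock det_scalar mulrC.
  by rewrite addrC.
pose x : {poly K} := 'X + a%:P.
have xK : GRing.rreg (x ^+ n).
  apply: monic_rreg; apply: monic_exp.
  by rewrite /x -[a]opprK polyCN monicXsubC.
have /(congr1 (horner_eval 0)) :=
  xK _ _ (det_cancel _ x (map_mx polyC B) (map_mx polyC C) (map_mx polyC D)).
have x0 : horner_eval 0 x = a by rewrite /horner_eval /x !hornerE.
have evalC (M : 'M[K]_n) : map_mx (horner_eval 0) (map_mx polyC M) = M.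
  by apply/matrixP => i j; rewrite !mxE /horner_eval hornerC.
rewrite -!det_map_mx map_block_mx map_scalar_mx map_mxB map_mxZ map_mxM /=.
by rewrite !evalC x0.
Qed.

Lemma det_add n (A B : 'M[K]_n) :
  \det (A + B) =
  \sum_(I : {set 'I_n}) \det (\matrix_(i, j) if i \in I then A i j else B i j).
Proof.
rewrite exchange_big; apply: eq_bigr => s _; rewrite -big_distrr; congr (_ * _).
under eq_bigr do rewrite mxE.
rewrite bigA_distr; apply: eq_bigr => I _; apply: eq_bigr => i _.
by rewrite mxE.
Qed.

(** Every f with values in J is the enumeration of J precomposed with a
    self-map of the positions; when f is injective, this self-map is a
    permutation, which gives the ranks in J of the values of f. *)
Lemma factor_nth_enum n (x0 : 'I_n) (J : {set 'I_n}) k (f : 'I_k -> 'I_n) :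
  #|J| = k -> (forall i, f i \in J) ->
  exists g : 'I_k -> 'I_k, forall i, f i = nth x0 (enum J) (g i).
Proof.
move=> cJ fJ; have lt i : (index (f i) (enum J) < k)%N.
  by rewrite -[X in (_ < X)%N]cJ cardE index_mem mem_enum.
by exists (fun i => Ordinal (lt i)) => i; rewrite nth_index ?mem_enum.
Qed.

Lemma nth_enum_inj n (x0 : 'I_n) (J : {set 'I_n}) k :
  #|J| = k -> injective (elt x0 k J).
Proof.
move=> cJ i j /eqP; rewrite nth_uniq ?enum_uniq // -?cardE ?cJ //.
by move/eqP/val_inj.
Qed.

(** Expanding the rows of A *m B gives a sum over all maps f from rows to
    columns. Non-injective maps contribute determinants with two equal rows.
    The injective maps with a given image J are the rearrangements of J by
    the permutations of 'I_k, and the sum of their signed products of entries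
    of A is the minor of A on J. *)
Lemma cauchy_binet n (x0 : 'I_n) k (A : 'M[K]_(k, n)) (B : 'M[K]_(n, k)) :
  \det (A *m B) = \sum_(J : {set 'I_n} | #|J| == k)
     \det (colsub (elt x0 k J) A) * \det (rowsub (elt x0 k J) B).
Proof.
pose term (f : {ffun 'I_k -> 'I_n}) := (\prod_i A i (f i)) * \det (rowsub f B).
have -> : \det (A *m B) = \sum_f term f.
  transitivity (\sum_(f : {ffun 'I_k -> 'I_n}) \sum_(s : 'S_k)
      (-1) ^+ s * \prod_i (A i (f i) * B (f i) (s i))).
    rewrite exchange_big; apply: eq_bigr => s _; rewrite -big_distrr /=.
    congr (_ * _); rewrite -(bigA_distr_bigA (fun i j => A i j * B j (s i))).
    by apply: eq_bigr => i _; rewrite mxE.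
  apply: eq_bigr => f _; rewrite /term /determinant big_distrr.
  apply: eq_bigr => s _ /=.
  rewrite big_split mulrCA /=; congr (_ * (_ * _)).
  by apply: eq_bigr => i _; rewrite mxE.
rewrite (bigID (fun f : {ffun 'I_k -> 'I_n} => injectiveb f)) /= addrC.
rewrite big1 ?add0r => [|f /injectivePn[i1 [i2 i12 fi12]]]; last first.
  rewrite /term (determinant_alternate i12) ?mulr0 // => j.
  by rewrite !mxE fi12.
rewrite (partition_big (fun f : {ffun 'I_k -> 'I_n} => f @: setT)
                       (fun J => #|J| == k)) /=; last first.
  by move=> f /injectiveP f_inj; rewrite card_imset // cardsT card_ord.
apply: eq_bigr => J /eqP cJ; set e := fun i : 'I_k => nth _ _ _.
have e_inj : injective e := nth_enum_inj cJ.
have eJ i : e i \in J by rewrite -mem_enum mem_nth // -cardE cJ.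
(* The injective maps with image J are exactly the h s. *)
pose h (s : 'S_k) := [ffun i => e (s i)].
have h_inj : {in [set: 'S_k] &, injective h}.
  move=> s t _ _ /ffunP st; apply/permP => i.
  by apply: e_inj; have := st i; rewrite !ffunE.
transitivity (\sum_(f in h @: [set: 'S_k]) term f).
  apply: eq_bigl => f.
  apply/andP/imsetP => [[/injectiveP f_inj /eqP fJ]|[s _ ->]].
    have /(factor_nth_enum x0 cJ)[g fg] : forall i, f i \in J.
      by move=> i; rewrite -fJ imset_f.
    have g_inj : injective g by move=> i j gij; apply: f_inj; rewrite !fg gij.
    by exists (perm g_inj) => //; apply/ffunP => i; rewrite ffunE permE fg.
  have hs_inj : injective (h s).
    by move=> i j; rewrite !ffunE => /e_inj/perm_inj.
  split; first exact/injectiveP.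
  rewrite eqEcard card_imset // cardsT card_ord cJ leqnn andbT.
  by apply/subsetP => _ /imsetP[i _ ->]; rewrite ffunE.
rewrite (big_imset _ h_inj) big_distrl.
under eq_bigl do rewrite inE.
apply: eq_bigr => s _; rewrite /term /=.
have -> : rowsub (h s) B = row_perm s (rowsub e B).
  by apply/matrixP => i j; rewrite !mxE ffunE.
rewrite row_permE det_mulmx det_perm mulrCA mulrA; congr (_ * _ * _).
by apply: eq_bigr => i _; rewrite mxE ffunE.
Qed.

(** Listing I before its complement makes the matrix block upper triangular,
    with the principal minor on I and a scalar block on the diagonal. *)
Lemma det_row_mixed n (x0 : 'I_n) a (M : 'M[K]_n) (I : {set 'I_n}) k :
  #|I| = k ->
  \det (\matrix_(i, j) if i \in I then M i j else a%:M i j) =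
  a ^+ (n - k) * \det (mxsub (elt x0 k I) (elt x0 k I) M).
Proof.
move=> cI; set P := matrix_of_fun _ _; set e := fun i : 'I_k => nth _ _ _.
have cIC : #|~: I| = (n - k)%N by rewrite cardsCs setCK card_ord cI.
have kn : (k + (n - k) = n)%N.
  by rewrite subnKC // -cI -[X in (_ <= X)%N]card_ord max_card.
pose e' (i : 'I_(n - k)) := nth x0 (enum (~: I)) i.
have e_inj : injective e := nth_enum_inj cI.
have e'_inj : injective e' := nth_enum_inj cIC.
have eI i : e i \in I by rewrite -mem_enum mem_nth // -cardE cI.
have e'I i : e' i \notin I.
  by rewrite -in_setC -mem_enum mem_nth // -cardE cIC.
(* g lists the elements of I, then those of its complement. *)
pose g i := match split i with inl j => e j | inr j => e' j end.
have gl i : g (lshift _ i) = e i by rewrite /g (unsplitK (inl i)).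
have gr i : g (rshift _ i) = e' i by rewrite /g (unsplitK (inr i)).
have g_inj : injective g.
  move=> i j; case: (split_ordP i) => i' ->; case: (split_ordP j) => j' ->.
  - by rewrite !gl => /e_inj ->.
  - by rewrite gl gr => ij; have := e'I j'; rewrite -ij eI.
  - by rewrite gl gr => ij; have := e'I i'; rewrite ij eI.
  - by rewrite !gr => /e'_inj ->.
rewrite -(det_mxsub_inj P kn g_inj).
suff -> : mxsub g g P = block_mx (mxsub e e M) (mxsub e e' M) 0 a%:M.
  by rewrite det_ublock det_scalar mulrC.
apply/matrixP => i j.
case: (split_ordP i) => i' ->; case: (split_ordP j) => j' ->.
- by rewrite block_mxEul !mxE !gl eI.
- by rewrite block_mxEur !mxE gl gr eI.
- rewrite block_mxEdl !mxE gl gr (negbTE (e'I _)).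
  by case: eqP => // ij; have := e'I i'; rewrite ij eI.
- by rewrite block_mxEdr !mxE !gr (negbTE (e'I _)) (inj_eq e'_inj).
Qed.

Lemma det_scalar_add_mulmx n (x0 : 'I_n) a b (A B : 'M[K]_n) :
  \det (a%:M + b *: (A *m B)) =
  \sum_(k < n.+1) a ^+ (n - k) * b ^+ k *
    \sum_(I : {set 'I_n} | #|I| == k) \sum_(J : {set 'I_n} | #|J| == k)
      \det (mxsub (elt x0 k I) (elt x0 k J) A) *
      \det (mxsub (elt x0 k J) (elt x0 k I) B).
Proof.
rewrite addrC det_add.
have card_lt (I : {set 'I_n}) : (#|I| < n.+1)%N.
  by rewrite ltnS -[X in (_ <= X)%N]card_ord max_card.
rewrite (partition_big (fun I => Ordinal (card_lt I)) xpredT) //=.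
apply: eq_bigr => k _; rewrite big_distrr /=.
apply: eq_big => // I /eqP/(congr1 val) /= cI.
rewrite (det_row_mixed x0 _ _ cI); set e := fun i : 'I_k => nth _ _ _.
have -> : mxsub e e (b *: (A *m B)) = b *: (rowsub e A *m colsub e B).
  by rewrite -mxsub_mul; apply/matrixP => i j; rewrite !mxE.
rewrite detZ mulrA (cauchy_binet x0); congr (_ * _); apply: eq_bigr => J _.
by congr (_ * _); congr (\det _); apply/matrixP => i j; rewrite !mxE.
Qed.

(** Subtracting Z times the second block row from the first turns the upper
    blocks into v and - s *: Z, and a scalar upper left block makes
    [det_block_scalar] applicable. *)
Lemma det_symbol_block n (Z T : 'M[K]_n) v s : Z^T = Z -> T^T = T ->
  \det (block_mx (v%:M - Z *m T) (Z *m T *m Z - (v + s) *: Z)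
                 (- T) (- (v%:M - Z *m T)^T)) =
  (-1) ^+ n * \det ((v ^+ 2)%:M + (s - v) *: (T *m Z)).
Proof.
move=> Z_sym T_sym; set M := block_mx _ _ _ _.
have -> : \det M = \det (block_mx v%:M (- (s *: Z)) (- T) (T *m Z - v%:M)).
  transitivity (\det (block_mx 1%:M (- Z) 0 1%:M *m M)).
    by rewrite det_mulmx det_ublock !det1 !mul1r.
  congr (\det _); rewrite mulmx_block !mul1mx !mul0mx !add0r.
  rewrite linearB /= trmx_mul Z_sym T_sym tr_scalar_mx opprB.
  congr block_mx; first by rewrite mulmxN mulNmx opprK addrNK.
  rewrite mulNmx mulmxBr mulmxA mul_mx_scalar scalerDl opprB.
  move: (Z *m T *m Z) (v *: Z) (s *: Z) => x y t.
  by rewrite opprD (addrA x) (addrAC (x - y)) addrA subrK subrr sub0r.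
rewrite det_block_scalar -detZ scaleN1r; congr (\det _).
rewrite mulNmx mulmxN opprK -scalemxAr scalerBr scale_scalar_mx scalerBl.
by rewrite opprD opprB [RHS]addrCA addrA.
Qed.

End Determinants.

(** * Block form of a combination of the basis of sp_n *)

Section SpMatrix.

Variable n : nat.

(** The index i stands for the i-th element of the list 1, ..., n, -1, ..., -n,
    in which - unlike in 1, ..., 2n - the negative indices come in the same
    order as the positive ones, so that the four blocks are indexed alike. *)
Definition pos_neg (i : 'I_(n + n)) : 'I_(n + n) :=
  match split i with inl j => pos j | inr j => neg j end.

Lemma pos_neg_pos i : pos_neg (lshift n i) = pos i.
Proof. by rewrite /pos_neg (unsplitK (inl i)). Qed.

Lemma pos_neg_neg i : pos_neg (rshift n i) = neg i.
Proof. by rewrite /pos_neg (unsplitK (inr i)). Qed.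

Lemma eq_pos (i j : 'I_n) : (pos i == pos j) = (i == j).
Proof. exact: (inj_eq (@lshift_inj n n)). Qed.

Lemma eq_neg (i j : 'I_n) : (neg i == neg j) = (i == j).
Proof. by rewrite (inj_eq rev_ord_inj) (inj_eq (@lshift_inj n n)). Qed.

Lemma eq_pos_neg (i j : 'I_n) : (pos i == neg j) = false.
Proof.
apply/eqP => /(congr1 val) /= ij; have := ltn_ord i.
by rewrite ij -addnBA // ltnNge leq_addr.
Qed.

Lemma eq_neg_pos (i j : 'I_n) : (neg i == pos j) = false.
Proof. by rewrite eq_sym eq_pos_neg. Qed.

Lemma pos_neg_inj : injective pos_neg.
Proof.
move=> i j; case: (split_ordP i) => i' ->; case: (split_ordP j) => j' ->;
  rewrite ?pos_neg_pos ?pos_neg_neg => /eqP;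
  by rewrite ?eq_pos ?eq_neg ?eq_pos_neg ?eq_neg_pos // => /eqP ->.
Qed.

Lemma sum_delta (L : nzRingType) (G : 'I_n -> 'I_n -> L) (i j : 'I_n) :
  \sum_(a < n) \sum_(b < n) G a b * ((i == a) && (j == b))%:R = G i j.
Proof.
rewrite (bigD1 i) //= (bigD1 j) //= !eqxx mulr1 !big1 ?addr0 //.
  move=> a ai; apply: big1 => b _.
  by rewrite eq_sym (negbTE ai) mulr0.
by move=> b bj; rewrite [j == b]eq_sym (negbTE bj) andbF mulr0.
Qed.

Variables (F : numFieldType) (L : lalgType F).

(** Off the diagonal exactly one of the two deltas meets the constraint
    a <= b; on the diagonal both do, which the factor 1/2 of the dual basis
    compensates for. *)
Lemma sum_upair_delta (B : 'M[L]_n) (i j : 'I_n) :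
  B^T = B ->
  \sum_(a < n) \sum_(b < n | (a <= b)%N)
     ((if a == b then 2^-1 else 1 : F) *: B a b) *
     (((i == a) && (j == b))%:R + ((i == b) && (j == a))%:R) = B i j.
Proof.
move=> /matrixP B_sym.
pose H (a b : 'I_n) : L :=
  if (a <= b)%N then (if a == b then 2^-1 else 1 : F) *: B a b else 0.
transitivity (H i j + H j i).
  rewrite -[in RHS](sum_delta H i j) -[X in _ + X](sum_delta H j i).
  rewrite -big_split; apply: eq_bigr => a _; rewrite -big_split big_mkcond.
  apply: eq_bigr => b _; rewrite /H; case: leqP => _ /=.
    by rewrite mulrDr [in X in _ + X]andbC.
  by rewrite !mul0r addr0.
have := B_sym i j; rewrite mxE /H [j == i]eq_sym => ->.
case: (ltngtP i j) => ij.
- by rewrite addr0 ifN ?scale1r // neq_ltn ij.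
- by rewrite add0r ifN ?scale1r // neq_ltn ij orbT.
- have -> : i = j by apply: val_inj.
  by rewrite eqxx -scalerDl -[2^-1]mul1r -Num.Theory.splitr scale1r.
Qed.

(** The coefficients cA, cB, cC are kept abstract, related to A, B, C by
    equations, so that the lemma applies to sums whose coefficients are given
    by other expressions than entries of matrices. *)
Lemma sum_sp_mx (A B C : 'M[L]_n) (cA cB cC : 'I_n -> 'I_n -> L) :
  B^T = B -> C^T = C ->
  (forall i j, cA i j = A i j) ->
  (forall i j, cB i j = (if i == j then 2^-1 else 1 : F) *: B i j) ->
  (forall i j, cC i j = (if i == j then 2^-1 else 1 : F) *: C i j) ->
  mxsub pos_neg pos_neg
    (\sum_(i < n) \sum_(j < n) cA i j *: sp_mx L (X0 i j)
     + \sum_(i < n) \sum_(j < n | (i <= j)%N) cB i j *: sp_mx L (Xp i j)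
     + \sum_(i < n) \sum_(j < n | (i <= j)%N) cC i j *: sp_mx L (Xm i j))
  = block_mx A B C (- A^T).
Proof.
move=> B_sym C_sym AE BE CE; apply/matrixP => p q; rewrite [LHS]mxE.
set x := pos_neg p; set y := pos_neg q.
have -> : forall M N P : 'M[L]_(n + n), (M + N + P) x y = M x y + N x y + P x y.
  by move=> M N P; rewrite !mxE.
have entry (P : rel 'I_n) (c : 'I_n -> 'I_n -> L)
    (X : 'I_n -> 'I_n -> 'M[L]_(n + n)) :
    (\sum_(i < n) \sum_(j < n | P i j) c i j *: X i j) x y
    = \sum_(i < n) \sum_(j < n | P i j) c i j * X i j x y.
  rewrite summxE; apply: eq_bigr => i _.
  by rewrite summxE; apply: eq_bigr => j _; rewrite mxE.
rewrite (entry (fun _ _ => true)) !(entry (fun i j => (i <= j)%N)).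
rewrite /x /y {entry x y}.
have zero (P : rel 'I_n) (c X : 'I_n -> 'I_n -> L) :
    (forall i j, X i j = 0) ->
    \sum_(i < n) \sum_(j < n | P i j) c i j * X i j = 0.
  by move=> X0; do 2![apply: big1 => ? _]; rewrite X0 mulr0.
case: (split_ordP p) => i ->; case: (split_ordP q) => j ->;
  rewrite ?pos_neg_pos ?pos_neg_neg.
- rewrite block_mxEul.
  rewrite [X in _ + X + _](zero (fun i j => (i <= j)%N)) => [|a b]; last first.
    by rewrite !mxE !eq_pos_neg !andbF addr0.
  rewrite [X in _ + X](zero (fun i j => (i <= j)%N)) => [|a b]; last first.
    by rewrite !mxE !eq_pos_neg addr0.
  rewrite !addr0 -[RHS](sum_delta A); do 2![apply: eq_bigr => ? _].
  by rewrite !mxE AE !eq_pos !eq_pos_neg subr0.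
- rewrite block_mxEur.
  rewrite [X in X + _ + _](zero (fun _ _ => true)) => [|a b]; last first.
    by rewrite !mxE !eq_pos_neg !eq_neg_pos andbF subr0.
  rewrite [X in _ + X](zero (fun i j => (i <= j)%N)) => [|a b]; last first.
    by rewrite !mxE !eq_pos_neg addr0.
  rewrite add0r addr0 -[RHS](sum_upair_delta _ _ B_sym).
  by do 2![apply: eq_bigr => ? _]; rewrite !mxE BE !eq_pos !eq_neg.
- rewrite block_mxEdl.
  rewrite [X in X + _ + _](zero (fun _ _ => true)) => [|a b]; last first.
    by rewrite !mxE !eq_pos_neg !eq_neg_pos andbF subr0.
  rewrite [X in _ + X + _](zero (fun i j => (i <= j)%N)) => [|a b]; last first.
    by rewrite !mxE !eq_neg_pos addr0.
  rewrite !add0r -[RHS](sum_upair_delta _ _ C_sym).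
  do 2![apply: eq_bigr => ? _]; rewrite !mxE CE !eq_pos !eq_neg.
  by rewrite addrC.
- rewrite block_mxEdr.
  rewrite [X in _ + X + _](zero (fun i j => (i <= j)%N)) => [|a b]; last first.
    by rewrite !mxE !eq_neg_pos addr0.
  rewrite [X in _ + X](zero (fun i j => (i <= j)%N)) => [|a b]; last first.
    by rewrite !mxE !eq_neg_pos !andbF addr0.
  rewrite !addr0 !mxE -[in RHS](sum_delta A) -sumrN; apply: eq_bigr => a _.
  rewrite -sumrN; apply: eq_bigr => b _.
  by rewrite !mxE AE !eq_neg !eq_neg_pos sub0r mulrN andbC.
Qed.

End SpMatrix.

(** * The matrix of symbols *)

Section Symbol.

Variables (R : realType) (n : nat) (s : int).

Local Notation S := {mpoly R[i][#|{: indet n}|]}.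
Local Notation Z := (zX R n).
Local Notation T := (txiX R n).
Local Notation v := (uX R n + gamma R n 1).

Lemma upair_ofC (i j : 'I_n) : upair_of i j = upair_of j i.
Proof.
apply: val_inj => /=; case: (ltngtP i j) => //= ij.
by have -> : i = j by apply: val_inj.
Qed.

Lemma zX_sym i j : Z i j = Z j i.
Proof. by rewrite !mxE upair_ofC. Qed.

Lemma txiX_sym i j : T i j = T j i.
Proof. by rewrite !mxE upair_ofC eq_sym. Qed.

Lemma minorE (x0 : 'I_n) k (A : 'M[S]_n) (I J : {set 'I_n}) :
  #|I| = k -> #|J| = k ->
  minor k A I J = \det (mxsub (elt x0 k I) (elt x0 k J) A).
Proof.
rewrite /minor => cI cJ; congr (\det _).
have conform m1 m2 (f : 'I_m1 -> 'I_n) (g : 'I_m2 -> 'I_n) :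
    m1 = k -> m2 = k -> (forall i, f i = nth x0 (enum I) i) ->
    (forall j, g j = nth x0 (enum J) j) ->
    conform_mx (0 : 'M_k) (mxsub f g A)
    = mxsub (elt x0 k I) (elt x0 k J) A.
  move=> m1k m2k; subst m1 m2 => fE gE; rewrite conform_mx_id.
  by apply/matrixP => i j; rewrite !mxE fE gE.
by apply: conform => // i; apply: enum_val_nth.
Qed.

Lemma gammaE (x0 : 'I_n) k :
  gamma R n k =
  \sum_(I : {set 'I_n} | #|I| == k) \sum_(J : {set 'I_n} | #|J| == k)
    \det (mxsub (elt x0 k I) (elt x0 k J) T) *
    \det (mxsub (elt x0 k J) (elt x0 k I) Z).
Proof.
apply: eq_bigr => I /eqP cI; apply: eq_bigr => J /eqP cJ.
rewrite (minorE x0 Z cI cJ) (minorE x0 T cI cJ) [LHS]mulrC.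
set e := elt x0 k I; set f := elt x0 k J.
suff -> : mxsub f e Z = (mxsub e f Z)^T by rewrite det_tr.
by apply/matrixP => i j; rewrite [LHS]mxE [RHS]mxE [RHS]mxE; apply: zX_sym.
Qed.

Lemma gamma1E : gamma R n 1 = \sum_k \sum_l Z k l * T k l.
Proof.
have sum_card1 (F : {set 'I_n} -> S) :
    \sum_(I : {set 'I_n} | #|I| == 1%N) F I = \sum_i F [set i].
  rewrite -(big_imset F (h := fun i => [set i])) /=; last first.
    by move=> i j _ _ /set1_inj.
  apply: eq_bigl => I; apply/cards1P/imsetP => [[i ->]|[i _ ->]]; by exists i.
rewrite /gamma sum_card1; apply: eq_bigr => i _.
rewrite sum_card1; apply: eq_bigr => j _.
by rewrite !(minorE i) ?cards1 // !det_mx11 !mxE !enum_set1.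
Qed.

Lemma trmx_zX : Z^T = Z.
Proof. by apply/matrixP => i j; rewrite mxE zX_sym. Qed.

Lemma trmx_txiX : T^T = T.
Proof. by apply/matrixP => i j; rewrite mxE txiX_sym. Qed.

(** Adding to the sum over l != i its missing column l = i completes it to
    gamma_1 and leaves the i-th diagonal entry of Z T to be subtracted. *)
Lemma tsigma_X0 i j :
  tsigma R s (X0 i j) = (v%:M - Z *m T) j i.
Proof.
rewrite [RHS]mxE [X in X + _]mxE [X in _ + X]mxE [X in _ - X]mxE.
rewrite gamma1E [j == i]eq_sym /tsigma.
case: eqP => [->|_]; last first.
  rewrite mulr0n sub0r; congr (- _); apply: eq_bigr => k _.
  by rewrite [T k i]txiX_sym.
rewrite mulr1n -addrA; congr (_ + _).
rewrite [in RHS](eq_bigr (fun k => Z k j * T k j +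
   \sum_(l < n | l != j) Z k l * T k l)); last by move=> k _; rewrite (bigD1 j).
rewrite big_split addrAC /=.
under [X in _ = X - _ + _]eq_bigr do rewrite zX_sym.
by rewrite subrr add0r.
Qed.

Lemma tsigma_Xm i j :
  tsigma R s (Xm i j) = (Z *m T *m Z - (v + s%:~R) *: Z) i j.
Proof.
have ZTZ : (Z *m T *m Z) i j = \sum_k \sum_l Z k i * Z j l * T k l.
  rewrite mxE exchange_big; apply: eq_bigr => l _; rewrite mxE big_distrl.
  apply: eq_bigr => k _; rewrite [Z k i]zX_sym [Z j l]zX_sym.
  exact: mulrAC.
rewrite [RHS]mxE ZTZ [X in _ + X]mxE [X in _ - X]mxE gamma1E /tsigma.
have -> : \sum_k \sum_l (Z k i * Z j l - Z i j * Z k l) * T k l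
        = \sum_k \sum_l Z k i * Z j l * T k l
          - Z i j * \sum_k \sum_l Z k l * T k l.
  rewrite mulr_sumr -sumrB; apply: eq_bigr => k _.
  rewrite mulr_sumr -sumrB; apply: eq_bigr => l _.
  by rewrite mulrBl mulrA.
have regroup (L : comNzRingType) (a b x y z : L) :
  - (a + b) * z + (x - z * y) = x - (a + y + b) * z by ring.
exact: regroup.
Qed.

Lemma tsigmaX_block :
  mxsub (@pos_neg n) (@pos_neg n) (tsigmaX R n s) =
  block_mx (v%:M - Z *m T) (Z *m T *m Z - (v + s%:~R) *: Z)
           (- T) (- (v%:M - Z *m T)^T).
Proof.
have B_sym : (Z *m T *m Z - (v + s%:~R) *: Z)^T
           = Z *m T *m Z - (v + s%:~R) *: Z.
  by rewrite linearB linearZ /= !trmx_mul trmx_zX trmx_txiX mulmxA.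
have C_sym : (- T)^T = - T by rewrite linearN /= trmx_txiX.
rewrite /tsigmaX; apply: (sum_sp_mx (F := R[i])) B_sym C_sym _ _ _ => i j.
- by rewrite /tsigma_dual scale1r tsigma_X0.
- by rewrite /tsigma_dual tsigma_Xm.
- by rewrite /tsigma_dual [in RHS]mxE.
Qed.

End Symbol.

Theorem corollary5p4 (R : realType) (n : nat) (hn : (1 <= n)%N) (s : int) :
  \det (tsigmaX R n s) =
    (-1) ^+ n *
    \sum_(0 <= k < n.+1)
       (uX R n + gamma R n 1) ^+ (2 * n - 2 * k) *
       (s%:~R - (uX R n + gamma R n 1)) ^+ k * gamma R n k.
Proof.
rewrite -(det_mxsub_inj _ erefl (@pos_neg_inj n)) tsigmaX_block.
rewrite (det_symbol_block _ _ (trmx_zX R n) (trmx_txiX R n)).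
rewrite (det_scalar_add_mulmx (Ordinal hn)) big_mkord.
apply: congr1; apply: eq_bigr => k _.
by rewrite -gammaE -mulnBr exprM.
Qed.
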